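(* The category $\mathrm{Mal}(\mathbf{Rel}_3^{\mathrm{op}})$ of Mal'tsev objects in $\mathbf{Rel}_3^{\mathrm{op}}$ is not a majority category.
   Context: $\mathbf{Rel}_3$ is the category whose objects are pairs $X=(U_X,R_X)$ with $U_X$ a set and $R_X\subseteq U_X^3$ a ternary relation on $U_X$; a morphism $f:X\to Y$ is a function $f:U_X\to U_Y$ with $(x,y,z)\in R_X\implies (f(x),f(y),f(z))\in R_Y$. $\mathbf{Rel}_3^{\mathrm{op}}$ is its dual. An object $S$ of a category $\mathbb{C}$ is a Mal'tsev object if for every binary relation in $\mathbb{C}$, i.e. every jointly monomorphic pair $r_1:R_0\to X$, $r_2:R_0\to Y$, the induced relation $\hom(S,R_0)\rightarrowtail\hom(S,X)\times\hom(S,Y)$ on sets is difunctional; a relation $\rho\subseteq P\times Q$ of sets is difunctional if $(x_1,y_2),(x_1,y_1),(x_2,y_1)\in\rho$ implies $(x_2,y_2)\in\rho$. $\mathrm{Mal}(\mathbb{C})$ is the full subcategory of $\mathbb{C}$ on the Mal'tsev objects. A ternary relation between objects $A,B,C$ of a category is a quadruple $R=(R_0,r_1,r_2,r_3)$ with $r_1:R_0\to A$, $r_2:R_0\to B$, $r_3:R_0\to C$ jointly monomorphic; a triple $(a,b,c)$ of morphisms $a:S\to A$, $b:S\to B$, $c:S\to C$ is $R$-related if there is $f:S\to R_0$ with $r_1f=a$, $r_2f=b$, $r_3f=c$. A category is a majority category if for any ternary relation $R$ between any objects $A,B,C$ and any morphisms $a_1,a_2:S\to A$, $b_1,b_2:S\to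 B$, $c_1,c_2:S\to C$: if $(a_1,b_1,c_2)$, $(a_1,b_2,c_1)$ and $(a_2,b_1,c_1)$ are $R$-related, then $(a_1,b_1,c_1)$ is $R$-related. *)

(* Defs.v *)
Set Implicit Arguments.
Unset Strict Implicit.
Unset Printing Implicit Defensive.

Record category := Category {
  obj : Type;
  hom : obj -> obj -> Type;
  idm : forall X, hom X X;
  (* [comp g f] is "g after f" *)
  comp : forall X Y Z, hom Y Z -> hom X Y -> hom X Z;
  comp_idl : forall X Y (f : hom X Y), comp (idm Y) f = f;
  comp_idr : forall X Y (f : hom X Y), comp f (idm X) = f;
  comp_assoc : forall W X Y Z (h : hom Y Z) (g : hom X Y) (f : hom W X),
    comp h (comp g f) = comp (comp h g) f
}.

Arguments hom {c} X Y.
Arguments idm {c} X.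
Arguments comp {c X Y Z} g f.

Definition op (C : category) : category := {|
  obj := obj C;
  hom := fun X Y => @hom C Y X;
  idm := fun X => @idm C X;
  comp := fun X Y Z (g : @hom C Z Y) (f : @hom C Y X) => @comp C Z Y X f g;
  comp_idl := fun X Y f => @comp_idr C Y X f;
  comp_idr := fun X Y f => @comp_idl C Y X f;
  comp_assoc := fun W X Y Z h g f => eq_sym (@comp_assoc C Z Y X W f g h)
|}.

Definition full_subcategory (C : category) (P : obj C -> Prop) : category := {|
  obj := {X : obj C | P X};
  hom := fun X Y => @hom C (proj1_sig X) (proj1_sig Y);
  idm := fun X => @idm C (proj1_sig X);
  comp := fun X Y Z => @comp C (proj1_sig X) (proj1_sig Y) (proj1_sig Z);
  comp_idl := fun X Y => @comp_idl C (proj1_sig X) (proj1_sig Y);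
  comp_idr := fun X Y => @comp_idr C (proj1_sig X) (proj1_sig Y);
  comp_assoc := fun W X Y Z =>
    @comp_assoc C (proj1_sig W) (proj1_sig X) (proj1_sig Y) (proj1_sig Z)
|}.

Record binary_relation (C : category) (X Y : obj C) := BinaryRelation {
  brel_obj : obj C;
  brel1 : hom brel_obj X;
  brel2 : hom brel_obj Y;
  brel_joint_mono : forall (T : obj C) (f g : hom T brel_obj),
    comp brel1 f = comp brel1 g -> comp brel2 f = comp brel2 g -> f = g
}.

Record ternary_relation (C : category) (X Y Z : obj C) := TernaryRelation {
  trel_obj : obj C;
  trel1 : hom trel_obj X;
  trel2 : hom trel_obj Y;
  trel3 : hom trel_obj Z;
  trel_joint_mono : forall (T : obj C) (f g : hom T trel_obj),
    comp trel1 f = comp trel1 g -> comp trel2 f = comp trel2 g ->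
    comp trel3 f = comp trel3 g -> f = g
}.

Definition difunctional (P Q : Type) (rho : P -> Q -> Prop) : Prop :=
  forall (x1 x2 : P) (y1 y2 : Q),
    rho x1 y2 -> rho x1 y1 -> rho x2 y1 -> rho x2 y2.

(* The image of hom(S, R0) >-> hom(S, X) x hom(S, Y). *)
Definition hom_relation (C : category) (S X Y : obj C)
    (R : binary_relation X Y) (a : hom S X) (b : hom S Y) : Prop :=
  exists f : hom S (brel_obj R), comp (brel1 R) f = a /\ comp (brel2 R) f = b.

Definition maltsev_object (C : category) (S : obj C) : Prop :=
  forall (X Y : obj C) (R : binary_relation X Y),
    difunctional (@hom_relation C S X Y R).

Definition Mal (C : category) : category :=
  full_subcategory (@maltsev_object C).

Definition related (C : category) (S X Y Z : obj C)
    (R : ternary_relation X Y Z) (a : hom S X) (b : hom S Y) (c : hom S Z)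
    : Prop :=
  exists f : hom S (trel_obj R),
    comp (trel1 R) f = a /\ comp (trel2 R) f = b /\ comp (trel3 R) f = c.

Definition majority_category (C : category) : Prop :=
  forall (X Y Z : obj C) (R : ternary_relation X Y Z) (S : obj C)
    (a1 a2 : hom S X) (b1 b2 : hom S Y) (c1 c2 : hom S Z),
    related R a1 b1 c2 -> related R a1 b2 c1 -> related R a2 b1 c1 ->
    related R a1 b1 c1.

Record rel3_obj := Rel3Obj {
  carrier : Type;
  rel3 : carrier -> carrier -> carrier -> Prop
}.

Definition preserves (X Y : rel3_obj) (f : carrier X -> carrier Y) : Prop :=
  forall x y z, rel3 x y z -> rel3 (f x) (f y) (f z).

Definition rel3_hom (X Y : rel3_obj) : Type :=
  {f : carrier X -> carrier Y | preserves f}.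

Definition rel3_id (X : rel3_obj) : rel3_hom X X :=
  exist (@preserves X X) (fun x => x) (fun x y z h => h).

Definition rel3_comp (X Y Z : rel3_obj)
    (g : rel3_hom Y Z) (f : rel3_hom X Y) : rel3_hom X Z :=
  exist (@preserves X Z) (fun x => proj1_sig g (proj1_sig f x))
    (fun x y z h => proj2_sig g _ _ _ (proj2_sig f _ _ _ h)).

Lemma rel3_comp_idl (X Y : rel3_obj) (f : rel3_hom X Y) :
  rel3_comp (rel3_id Y) f = f.
Proof. destruct f; reflexivity. Qed.

Lemma rel3_comp_idr (X Y : rel3_obj) (f : rel3_hom X Y) :
  rel3_comp f (rel3_id X) = f.
Proof. destruct f; reflexivity. Qed.

Definition Rel3 : category := {|
  obj := rel3_obj;
  hom := rel3_hom;
  idm := rel3_id;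
  comp := rel3_comp;
  comp_idl := rel3_comp_idl;
  comp_idr := rel3_comp_idr;
  comp_assoc := fun W X Y Z h g f => eq_refl
|}.

(* Main.v *)
Require Import Defs.
From Stdlib Require Import FunctionalExtensionality PropExtensionality
  ProofIrrelevance.

(** Dualising, a relation in [op Rel3] is a jointly epimorphic family of maps
    into [R0], which in [Rel3] means a jointly surjective one.  Being related
    means extending along it to a map out of [R0].  Difunctionality of the
    relation induced on maps [R0 -> S] therefore asks that a partial Mal'tsev
    operation [p x x z = z], [p x y y = x] of [S] preserve the ternary relation
    of [S].  This operation acts on columns of the form [(x, x, z)] or
    [(x, y, y)]; among the three columns of a ternary relation two have the
    same form.  So if any two entries of a related triple determine the third,
    the operation always returns one of the triples it was given
    ([thin_maltsev]): every such object is a Mal'tsev object.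

    Majority is a condition of arity three, and this property does not control
    it.  Exactly-one-is-true on [bool] contains [(0,0,1)], [(0,1,0)] and
    [(1,0,0)], any two entries of a triple determine the third, and yet the
    coordinatewise majority [(0,0,0)] is missing.  The failure is transported
    into the category by the three-element object carrying a single related
    triple of distinct elements, which represents the relation: maps from it to
    [S] are exactly the related triples of [S].  It is covered by three points
    with empty relation, that is, it is a ternary relation in the dual. *)

Lemma rel3_hom_ext (X Y : rel3_obj) (f g : rel3_hom X Y) :
  (forall x, proj1_sig f x = proj1_sig g x) -> f = g.
Proof.
  intros E. destruct f as [f Hf], g as [g Hg]; simpl in E.
  apply functional_extensionality in E. subst g.
  f_equal. apply proof_irrelevance.
Qed.

Lemma rel3_hom_eq (X Y : rel3_obj) (f g : rel3_hom X Y) (x : carrier X) :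
  f = g -> proj1_sig f x = proj1_sig g x.
Proof. intros ->; reflexivity. Qed.

(** A full relation makes every function into its carrier a morphism, so the
    characteristic function of the union of the two images can be compared with
    the constant [True]; both restrict to [True] along the two legs. *)
Lemma op_relation_covers (X Y : obj (op Rel3)) (R : binary_relation X Y)
    (u : carrier (brel_obj R)) :
  (exists x, proj1_sig (brel1 R) x = u) \/
  (exists y, proj1_sig (brel2 R) y = u).
Proof.
  pose (T := {| carrier := Prop; rel3 := fun _ _ _ => True |}).
  pose (f := exist (@preserves (brel_obj R) T)
    (fun v => (exists x, proj1_sig (brel1 R) x = v) \/
              (exists y, proj1_sig (brel2 R) y = v))
    (fun _ _ _ _ => I) : rel3_hom (brel_obj R) T).
  pose (g := exist (@preserves (brel_obj R) T) (fun _ => True)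
    (fun _ _ _ _ => I) : rel3_hom (brel_obj R) T).
  assert (E : f = g).
  { apply (@brel_joint_mono (op Rel3) X Y R T f g);
      apply rel3_hom_ext; intros x; apply propositional_extensionality;
      simpl; split; eauto. }
  change (proj1_sig f u). rewrite E. exact I.
Qed.

Definition thin (S : rel3_obj) : Prop :=
  forall x y z x' y' z' : carrier S, rel3 x y z -> rel3 x' y' z' ->
    (y = y' -> z = z' -> x = x') /\
    (x = x' -> z = z' -> y = y') /\
    (x = x' -> y = y' -> z = z').

(** Decidable equality serves to define the Mal'tsev operation
    [p x y z := if x = y then z else x] on the whole carrier, and hence the
    fourth map as a function on [R0] without choosing preimages. *)
Lemma thin_maltsev (S : rel3_obj)
    (eq_dec : forall x y : carrier S, {x = y} + {x <> y}) :
  thin S -> @maltsev_object (op Rel3) S.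
Proof.
  intros HS X Y R a1 a2 b1 b2 [f12 [A12 B12]] [f11 [A11 B11]] [f21 [A21 B21]].
  simpl in f12, f11, f21.
  pose (h u := if eq_dec (proj1_sig f12 u) (proj1_sig f11 u)
               then proj1_sig f21 u else proj1_sig f12 u).
  assert (hX : forall x, let u := proj1_sig (brel1 R) x in
    proj1_sig f12 u = proj1_sig f11 u /\ h u = proj1_sig f21 u).
  { intros x u.
    assert (E : proj1_sig f12 u = proj1_sig f11 u).
    { apply (rel3_hom_eq _ _ _ _ x (eq_trans A12 (eq_sym A11))). }
    split; [exact E | unfold h; destruct (eq_dec _ _); congruence]. }
  assert (hY : forall y, let u := proj1_sig (brel2 R) y in
    proj1_sig f11 u = proj1_sig f21 u /\ h u = proj1_sig f12 u).
  { intros y u.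
    assert (E : proj1_sig f11 u = proj1_sig f21 u).
    { apply (rel3_hom_eq _ _ _ _ y (eq_trans B11 (eq_sym B21))). }
    split; [exact E | unfold h; destruct (eq_dec _ _); congruence]. }
  assert (hcases : forall u,
    (proj1_sig f12 u = proj1_sig f11 u /\ h u = proj1_sig f21 u) \/
    (proj1_sig f11 u = proj1_sig f21 u /\ h u = proj1_sig f12 u)).
  { intros u. destruct (op_relation_covers _ _ R u) as [[x <-] | [y <-]];
      [left; apply hX | right; apply hY]. }
  assert (hpres : @preserves (brel_obj R) S h).
  { intros u v w Huvw.
    pose proof (proj2_sig f12 _ _ _ Huvw) as R12.
    pose proof (proj2_sig f11 _ _ _ Huvw) as R11.
    pose proof (proj2_sig f21 _ _ _ Huvw) as R21.
    destruct (HS _ _ _ _ _ _ R12 R11) as (P1 & P2 & P3).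
    destruct (HS _ _ _ _ _ _ R11 R21) as (Q1 & Q2 & Q3).
    (* Two of [u], [v], [w] lie over the same leg.  If it is the first, [f12]
       and [f11] agree at these two and so at the third, and [h] is [f21] at
       all three.  If it is the second, [f11] and [f21] agree throughout, and
       [h] is [f12]. *)
    assert ((h u = proj1_sig f21 u /\ h v = proj1_sig f21 v /\
             h w = proj1_sig f21 w) \/
            (h u = proj1_sig f12 u /\ h v = proj1_sig f12 v /\
             h w = proj1_sig f12 w)) as [(-> & -> & ->) | (-> & -> & ->)];
      [ | exact R21 | exact R12].
    destruct (hcases u) as [[] | []], (hcases v) as [[] | []],
      (hcases w) as [[] | []];
      solve [left; repeat split; intuition congruence
            | right; repeat split; intuition congruence]. }
  exists (exist (@preserves (brel_obj R) S) h hpres).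
  rewrite <- A21, <- B12.
  split; apply rel3_hom_ext; intros x; simpl; [apply hX | apply hY].
Qed.

Definition point : rel3_obj :=
  {| carrier := unit; rel3 := fun _ _ _ => False |}.

Inductive axis : Type := axis1 | axis2 | axis3.

Definition triple : rel3_obj :=
  {| carrier := axis;
     rel3 := fun i j k => i = axis1 /\ j = axis2 /\ k = axis3 |}.

Definition exactly_one (x y z : bool) : Prop :=
  match x, y, z with
  | true, false, false | false, true, false | false, false, true => True
  | _, _, _ => False
  end.

Definition one_of_three : rel3_obj :=
  {| carrier := bool; rel3 := exactly_one |}.

Lemma maltsev_point : @maltsev_object (op Rel3) point.
Proof.
  apply thin_maltsev; [intros x y; decide equality |].
  intros ? ? ? ? ? ? [].
Qed.

Lemma maltsev_triple : @maltsev_object (op Rel3) triple.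
Proof.
  apply thin_maltsev; [intros x y; decide equality |].
  intros ? ? ? ? ? ? (-> & -> & ->) (-> & -> & ->). auto.
Qed.

Lemma maltsev_one_of_three : @maltsev_object (op Rel3) one_of_three.
Proof.
  apply thin_maltsev; [intros x y; decide equality |].
  intros [] [] [] [] [] [] [] []; repeat split; congruence.
Qed.

Definition Point : obj (Mal (op Rel3)) := exist _ point maltsev_point.
Definition Triple : obj (Mal (op Rel3)) := exist _ triple maltsev_triple.
Definition OneOfThree : obj (Mal (op Rel3)) :=
  exist _ one_of_three maltsev_one_of_three.

Definition point_map (S : rel3_obj) (s : carrier S) : rel3_hom point S :=
  exist (@preserves point S) (fun _ => s) (fun _ _ _ h => False_ind _ h).

Lemma triple_map_ext (S : rel3_obj) (f g : rel3_hom triple S) :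
  (forall i, rel3_comp f (point_map triple i) =
             rel3_comp g (point_map triple i)) -> f = g.
Proof.
  intros E. apply rel3_hom_ext. intros i.
  apply (rel3_hom_eq point _ _ _ tt (E i)).
Qed.

Definition points_of_triple :
  @ternary_relation (Mal (op Rel3)) Point Point Point.
Proof.
  refine (@TernaryRelation (Mal (op Rel3)) Point Point Point Triple
    (point_map triple axis1) (point_map triple axis2)
    (point_map triple axis3) _).
  intros T f g E1 E2 E3.
  apply triple_map_ext. intros []; assumption.
Defined.

(** A map from [triple] to [S] amounts to a related triple of [S]: the one
    related triple of its source exhausts the elements of the source and
    imposes the only constraint. *)
Lemma related_points (S : obj (Mal (op Rel3)))
    (x y z : carrier (proj1_sig S)) :
  @related (Mal (op Rel3)) S Point Point Point points_of_triple
    (point_map (proj1_sig S) x) (point_map (proj1_sig S) y)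
    (point_map (proj1_sig S) z) <->
  rel3 x y z.
Proof.
  split.
  - intros [f (Ex & Ey & Ez)]. simpl in f.
    apply (rel3_hom_eq point _ _ _ tt) in Ex, Ey, Ez. simpl in Ex, Ey, Ez.
    rewrite <- Ex, <- Ey, <- Ez.
    apply (proj2_sig f). repeat split.
  - intros H.
    assert (P : @preserves triple (proj1_sig S)
      (fun i => match i with axis1 => x | axis2 => y | axis3 => z end)).
    { intros i j k (-> & -> & ->). exact H. }
    exists (exist _ _ P). repeat split; apply rel3_hom_ext; reflexivity.
Qed.

Theorem proposition6 : ~ majority_category (Mal (op Rel3)).
Proof.
  intros M.
  pose (a := point_map one_of_three).
  specialize (M Point Point Point points_of_triple OneOfThree
    (a false) (a true) (a false) (a true) (a false) (a true)).
  apply (related_points OneOfThree false false false), M;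
    apply (related_points OneOfThree); exact I.
Qed.
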